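(* For each positive integer $n$ let $N_3=3(n+1)$ and $b\in\mathbb{Z}_{N_3}$. Then, as $n\to\infty$, $$M_{3,2,n}(b)=\begin{cases}\dfrac{2\cdot 3^{2n+1}}{n+1}(1+o(1)),& 3\mid b,\\[2mm] -\dfrac{3^{2n+1}}{n+1}(1+o(1)),&\text{otherwise.}\end{cases}$$ In particular, $M_{3,2,n}(b)>0$ when $b\equiv 0\pmod 3$ and $M_{3,2,n}(b)<0$ when $b\not\equiv 0\pmod 3$, for all $n>0$.
   Context: For a prime $p$ and positive integers $s,n$, put $N_p=(n+1)p$, $D_p=\{x\in\mathbb{Z}:1\leq x\leq pn+p-1,\ p\nmid x\}$, and for $b\in\mathbb{Z}_{N_p}$ let $M_{p,s,n}(b)=\sum (-1)^{|V_1|+\cdots+|V_s|}$, the sum over all $s$-tuples $(V_1,\ldots,V_s)$ of subsets of $D_p$ with $\sum_{i=1}^s\sum_{x\in V_i}x\equiv b\pmod{N_p}$. Equivalently, $M_{p,s,n}(b)$ is the sum of the coefficients of $q^i$, $i\equiv b\pmod{N_p}$, in $\prod_{j=0}^n\prod_{k=1}^{p-1}(1-q^{pj+k})^s$. *)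

(* Defs.v *)
From HB Require Import structures.
From mathcomp Require Import all_boot all_order all_algebra.

Set Implicit Arguments.
Unset Strict Implicit.
Unset Printing Implicit Defensive.

Import GRing.Theory.
Local Open Scope ring_scope.

Definition modN (p n : nat) : nat := (n.+1 * p)%N.

(* The bound p * n + p - 1 equals (modN p n).-1, so 'I_(modN p n) holds every
   integer between 1 and that bound. *)
Definition setD (p n : nat) : {set 'I_(modN p n)} :=
  [set x : 'I_(modN p n) | (1 <= x <= p * n + p - 1)%N && ~~ (p %| x)%N].

(* For p a prime, modN p n > 1, so 'Z_(modN p n) really is the ring of
   integers modulo modN p n. *)
Definition M (p s n : nat) (b : 'Z_(modN p n)) : int :=
  \sum_(V : {ffun 'I_s -> {set 'I_(modN p n)}} |
          [forall i, V i \subset setD p n] &&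
          (\sum_(i < s) \sum_(x in V i) (nat_of_ord x)%:R == b))
     (-1) ^+ (\sum_(i < s) #|V i|)%N.

(* Main.v *)
Require Import Defs.
From mathcomp Require Import all_boot all_order all_algebra all_field.
From mathcomp Require Import all_classical all_reals all_analysis.
From mathcomp Require Import ring lra zify.
Import Order.TTheory GRing.Theory Num.Theory.
Import numFieldNormedType.Exports.
Local Open Scope classical_set_scope.
Local Open Scope ring_scope.

(** Write m = n + 1, N = 3 m and P(x) for the product of the 1 - x^i over the
    i < N prime to 3. Discrete Fourier inversion over the N-th roots of unity
    gives N * M(b) = sum_x x^(-b) P(x)^2. If x^3 has order d, grouping the
    factors by residues mod 3 gives P(x) = ((1 - u)(1 - u^2))^(m / d), where
    u = x^d is a cube root of unity, so P(x) is 0 or 3^(m / d). The two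
    primitive cube roots of unity contribute 9^m times 2 or -1 according to
    whether 3 divides b; for all other x, d = 1 and x = 1, or d >= 2, so that
    |P(x)^2| <= 3^m. Hence |N M(b) - 9^m c| <= N 3^m with c = 2 or -1, and
    N < 3^m as soon as m >= 2. *)

(** * Products of [1 - x ^+ i] over powers of a root of unity *)

(** Evaluate the factorisation of X^d - 1 at [a^-1] and multiply by [a ^+ d]; [a = 0] is treated
    apart. *)
Lemma prod_oneB_prim_root (F : fieldType) (d : nat) (w a : F) :
  d.-primitive_root w -> \prod_(0 <= i < d) (1 - w ^+ i * a) = 1 - a ^+ d.
Proof.
move=> w_prim; have d_gt0 := prim_order_gt0 w_prim.
have [->|a_neq0] := eqVneq a 0.
  by rewrite expr0n gtn_eqF // subr0 big1 // => i _; rewrite mulr0 subr0.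
have /(congr1 (fun q => q.[a^-1])) := factor_Xn_sub_1 w_prim.
rewrite horner_prod !hornerE => E.
transitivity (a ^+ d * (a ^- d - 1)); last first.
  by rewrite mulrBr mulr1 mulfV ?expf_neq0.
rewrite -exprVn -E -[in a ^+ d](subn0 d) -prodr_const_nat -big_split /=.
by apply: eq_bigr => i _; rewrite !hornerE mulrBr mulfV // mulrC.
Qed.

Lemma prod_oneB_prim_root_mul (F : fieldType) (d e : nat) (w a : F) :
  d.-primitive_root w ->
  \prod_(0 <= i < e * d) (1 - w ^+ i * a) = (1 - a ^+ d) ^+ e.
Proof.
move=> w_prim; rewrite big_nat_mul -[e in RHS]subn0 -prodr_const_nat.
apply: eq_bigr => j _; rewrite -(prod_oneB_prim_root _ _ _ a w_prim).
rewrite -{1}[(j * d)%N]add0n big_addn mulSn addnK.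
by apply: eq_bigr => i _; rewrite exprD mulnC exprM (prim_expr_order w_prim) expr1n mulr1.
Qed.

(** Write i = j p + k with 0 < k < p, so that x^i = (x^p)^j x^k. For fixed k, the index j runs
    through [e] full periods of [x ^+ p]. *)
Lemma prod_oneB_expr_not_dvd (F : fieldType) (p d e : nat) (x : F) :
  (0 < p)%N -> d.-primitive_root (x ^+ p) ->
  \prod_(i < e * d * p | ~~ (p %| i)%N) (1 - x ^+ i) =
  (\prod_(1 <= k < p) (1 - (x ^+ d) ^+ k)) ^+ e.
Proof.
move=> p_gt0 x_prim.
rewrite -(big_mkord (fun i => ~~ (p %| i)%N) (fun i => 1 - x ^+ i)) big_mkcond.
rewrite big_nat_mul -prodrXl.
under eq_bigr => j _.
  rewrite -{1}[(j * p)%N]add0n big_addn mulSn addnK big_ltn // add0n.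
  rewrite dvdn_mull //= mul1r.
  under eq_big_nat => k /andP[k_gt0 k_lt].
    rewrite dvdn_addl ?dvdn_mull // gtnNdvd //= exprD mulrC mulnC exprM.
    over.
  over.
rewrite exchange_big /=; apply: eq_bigr => k _.
by rewrite (prod_oneB_prim_root_mul _ _ _ _ _ x_prim) exprAC.
Qed.

(** * Generating function and Fourier inversion *)

Lemma sum_signed_subsets (F : comPzRingType) (I : finType) (D : {set I})
    (f : I -> nat) (x : F) :
  \sum_(A : {set I} | A \subset D) (-1) ^+ #|A| * x ^+ (\sum_(i in A) f i) =
  \prod_(i in D) (1 - x ^+ f i).
Proof.
rewrite [RHS]big_mkcond /=.
(* A factor outside [D] is written 0 + 1, so that in the expansion every subset not contained in [D]
   contributes 0. *)
under [RHS]eq_bigr => i _.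
  rewrite (_ : (if _ then _ else _) = (if i \in D then - x ^+ f i else 0) + 1);
    last by case: ifP => _; ring.
  over.
rewrite bigA_distr big_mkcond /=; apply: eq_bigr => A _.
case: ifP => [/fintype.subsetP sAD | /negbT/fintype.subsetPn[i iA iD]]; last first.
  by rewrite (bigD1 i) //= iA (negPf iD) mul0r.
rewrite -big_mkcond /= -prodr_const -prodrXr -big_split /=.
by apply: eq_bigr => i /sAD ->; rewrite mulN1r.
Qed.

(** Orthogonality of characters: a geometric sum whose ratio is an N-th root of unity other than 1
    vanishes. *)
Lemma sum_prim_root_expr (F : fieldType) (N S b : nat) (z : F) :
  N.-primitive_root z ->
  \sum_(k < N) (z ^+ S / z ^+ b) ^+ k = (if S == b %[mod N] then N%:R else 0).
Proof.
move=> z_prim; have N_gt0 := prim_order_gt0 z_prim.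
have z_neq0 : z != 0.
  by apply: contra_eq_neq (prim_expr_order z_prim) => ->; rewrite
    expr0n gtn_eqF // eq_sym oner_eq0.
rewrite -(eq_prim_root_expr z_prim); case: eqP => [->|/eqP neq].
  rewrite mulfV ?expf_neq0 //; under eq_bigr do rewrite expr1n.
  by rewrite sumr_const card_ord.
have u_neq1 : z ^+ S / z ^+ b - 1 != 0.
  by rewrite subr_eq0 -(inj_eq (mulIf (expf_neq0 b z_neq0))) divfK ?expf_neq0 ?mul1r.
apply: (mulfI u_neq1); rewrite -subrX1 mulr0 expr_div_n ![(z ^+ _) ^+ N]exprAC.
by rewrite (prim_expr_order z_prim) // !expr1n divr1 subrr.
Qed.

Lemma modN_gt1 (p n : nat) : (1 < p)%N -> (1 < modN p n)%N.
Proof. by rewrite /modN; nia. Qed.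

(** Each power of the product expands into a signed sum over [s]-tuples of subsets; after exchanging
    the sums, orthogonality selects the tuples of total [b] modulo N. *)
Lemma M_fourier (F : fieldType) (p s n : nat) (b : 'Z_(modN p n)) (z : F) :
  (1 < p)%N -> (modN p n).-primitive_root z ->
  (modN p n)%:R * (M s b)%:~R =
  \sum_(k < modN p n) z ^- (b * k) *
     (\prod_(i < modN p n | ~~ (p %| i)%N) (1 - (z ^+ k) ^+ i)) ^+ s.
Proof.
move=> p_gt1 z_prim; have N_gt1 := modN_gt1 _ n p_gt1.
set N := modN p n in b z_prim N_gt1 *.
(* The upper bound in [setD] is N - 1, and 0 is excluded because [p] divides it. *)
have DE (x : 'I_N) : (x \in Defs.setD p n) = ~~ (p %| x)%N.
  rewrite inE; case: (boolP (p %| x)%N) => [_|nx]; first by rewrite andbF.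
  rewrite andbT lt0n; have := ltn_ord x; rewrite {2}/N /modN => xN.
  have -> : (x <= p * n + p - 1)%N by nia.
  by rewrite andbT; apply: contraNneq nx => ->.
have MN (V : {ffun 'I_s -> {set 'I_N}}) :
    (\sum_(i < s) \sum_(x in V i) (nat_of_ord x)%:R == b) =
    ((\sum_(i < s) \sum_(x in V i) x)%N == b %[mod N]).
  under eq_bigr do rewrite -natr_sum.
  rewrite -natr_sum -(inj_eq val_inj) /= val_Zp_nat //.
  by rewrite [(b %% N)%N]modn_small // -[ltnRHS](Zp_cast N_gt1) ltn_ord.
have powE (k : 'I_N) :
    (\prod_(i < N | ~~ (p %| i)%N) (1 - (z ^+ k) ^+ i)) ^+ s =
    \sum_(V : {ffun 'I_s -> {set 'I_N}} | [forall i, V i \subset Defs.setD p n])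
       (-1) ^+ (\sum_(i < s) #|V i|)%N *
       (z ^+ k) ^+ (\sum_(i < s) \sum_(x in V i) x)%N.
  rewrite -(eq_bigl _ _ DE) -(sum_signed_subsets _ _ _ (@nat_of_ord N)).
  rewrite -[s in LHS]card_ord -prodr_const bigA_distr_big.
  apply: eq_big => [V | V _].
    by apply/ffun_onP/forallP => h i; have := h i; rewrite ?inE.
  by rewrite big_split /= !prodrXr.
under eq_bigr do rewrite powE mulr_sumr.
rewrite exchange_big /= /M rmorph_sum /= mulr_sumr big_mkcondr /=.
apply: eq_bigr => V _; rewrite MN.
transitivity ((-1) ^+ (\sum_(i < s) #|V i|)%N *
    \sum_(k < N) (z ^+ (\sum_(i < s) \sum_(x in V i) x)%N / z ^+ b) ^+ k).
  rewrite sum_prim_root_expr //; case: ifP => _; last by rewrite mulr0.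
  by rewrite rmorphXn /= rmorphN1 mulrC.
rewrite mulr_sumr; apply: eq_bigr => k _.
by rewrite expr_div_n -!exprM [RHS]mulrCA [(k * _)%N]mulnC [X in _ = _ * X]mulrC.
Qed.

(** * Cube roots of unity and the estimate for p = 3, s = 2 *)

Lemma sum_dvdn_ord (V : nmodType) (m k : nat) (f : nat -> V) :
  (0 < m)%N -> \sum_(i < k * m | (m %| i)%N) f i = \sum_(j < k) f (j * m)%N.
Proof.
move=> m_gt0; rewrite -(big_mkord (fun i => m %| i)%N f) big_mkcond.
rewrite big_nat_mul big_mkord; apply: eq_bigr => j _.
rewrite -{1}[(j * m)%N]add0n big_addn mulSn addnK big_ltn // add0n.
rewrite dvdn_mull // big_nat big1 => [|i /andP[i_gt0 i_lt]]; first exact: addr0.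
by rewrite dvdn_addl ?dvdn_mull // gtnNdvd.
Qed.

(** If [u != 1] then 1 + u + u^2 = 0. This serves twice: to evaluate (1 - u)(1 - u^2), and to add
    the contributions of the two primitive cube roots of unity. *)
Lemma cube_root1_sum (F : fieldType) (u : F) :
  u ^+ 3 = 1 -> u + u ^+ 2 = if u == 1 then 2 else -1.
Proof.
move=> u3; case: eqP => [->|/eqP u_neq1]; first by rewrite expr1n.
have u1 : u - 1 != 0 by rewrite subr_eq0.
by apply: (mulfI u1); ring: u3.
Qed.

Lemma cube_root1_prod (F : fieldType) (u : F) :
  u ^+ 3 = 1 ->
  \prod_(1 <= k < 3) (1 - u ^+ k) = if u == 1 then 0 else 3.
Proof.
move=> u3; rewrite big_nat_recr // big_nat1 /= expr1.
have -> : (1 - u) * (1 - u ^+ 2) = 2 - (u + u ^+ 2) by ring: u3.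
by rewrite cube_root1_sum //; case: ifP => _; ring.
Qed.

(** The case d = 1; the value [0 ^+ m] also covers the empty product at [m = 0]. *)
Lemma prod_oneB_cube_root1 (F : fieldType) (m : nat) (x : F) :
  x ^+ 3 = 1 ->
  \prod_(i < m * 3 | ~~ (3 %| i)%N) (1 - x ^+ i) =
  if x == 1 then 0 ^+ m else 3 ^+ m.
Proof.
move=> x3; have p1 : 1.-primitive_root (x ^+ 3).
  rewrite x3; apply/andP; split=> //; apply/forallP => i.
  by rewrite ord1 unity_rootE expr1n !eqxx.
have := @prod_oneB_expr_not_dvd F 3 1 m x isT p1.
by rewrite muln1 expr1 => ->; rewrite cube_root1_prod //; case: ifP.
Qed.

(** The order d of [x ^+ 3] is at least 2, so with m = e d the square is at most 3^(2e), hence at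
    most 3^m. *)
Lemma norm_prod_oneB_not_cube_root1 (F : numFieldType) (m : nat) (x : F) :
  (0 < m)%N -> x ^+ (m * 3) = 1 -> x ^+ 3 != 1 ->
  `|(\prod_(i < m * 3 | ~~ (3 %| i)%N) (1 - x ^+ i)) ^+ 2| <= 3 ^+ m.
Proof.
move=> m_gt0 xN x3; have x3m : (x ^+ 3) ^+ m = 1 by rewrite -exprM mulnC.
have [d d_prim /dvdnP[e m_eq]] := prim_order_exists m_gt0 x3m.
rewrite m_eq (@prod_oneB_expr_not_dvd F 3 d e x isT d_prim).
have u3 : (x ^+ d) ^+ 3 = 1 by rewrite exprAC prim_expr_order.
have d_gt1 : (1 < d)%N.
  rewrite ltn_neqAle (prim_order_gt0 d_prim) andbT; apply: contraNneq x3 => d1.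
  by apply/eqP; have := prim_expr_order d_prim; rewrite -d1 expr1.
rewrite cube_root1_prod //; case: ifP => _.
  rewrite -exprM expr0n normr_nat; apply: le_trans (exprn_ege1 _ _); last by rewrite ler1n.
  by rewrite lern1 leq_b1.
rewrite -exprM ger0_norm ?exprn_ge0 //; apply: ler_weXn2l; first by rewrite ler1n.
by rewrite leq_mul2l d_gt1 orbT.
Qed.

Lemma M_3_2_bound (n : nat) (b : 'Z_(modN 3 n)) :
  `|(n.+1 * 3)%:R * M 2 b - 9 ^+ n.+1 * (if (3 %| b)%N then 2 else -1)|
  <= (n.+1 * 3)%:R * 3 ^+ n.+1.
Proof.
set m := n.+1; set N := (m * 3)%N.
have [z z_prim] := C_prim_root_exists (isT : (0 < N)%N).
have w_prim : 3.-primitive_root (z ^+ m).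
  by have := dvdn_prim_root z_prim (dvdn_mull m (dvdnn 3)); rewrite mulnK.
pose g k : algC := z ^- (b * k) *
  (\prod_(i < N | ~~ (3 %| i)%N) (1 - (z ^+ k) ^+ i)) ^+ 2.
(* The indices divisible by [m] are those where [z ^+ k] is a cube root of unity; they give the main
   term, the others the error. *)
have cubeE k : ((z ^+ k) ^+ 3 == 1) = (m %| k)%N.
  by rewrite -exprM -(prim_order_dvd z_prim) dvdn_pmul2r.
have NM : N%:R * (M 2 b)%:~R = \sum_(k < N) g k :> algC.
  exact: (M_fourier _ 3 2 n b z isT z_prim).
have main : \sum_(k < N | (m %| k)%N) g k =
    9 ^+ m * (if (3 %| b)%N then 2 else -1).
  have gE j : g (j * m)%N = z ^- (b * (j * m)) * (if (3 %| j)%N then 0 else 9 ^+ m).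
    rewrite /g prod_oneB_cube_root1; last by apply/eqP; rewrite cubeE dvdn_mull.
    rewrite -(prim_order_dvd z_prim) /N [(m * 3)%N]mulnC dvdn_pmul2r //; congr (_ * _).
    by case: ifP => _; [rewrite expr0n /= expr0n | rewrite exprAC; congr (_ ^+ _); ring].
  (* The index j = 0 contributes 0, while j = 1, 2 contribute 9^m (v + v^2), and [v = 1] exactly
     when 3 divides [b]. *)
  pose v := (z ^+ m) ^- b.
  have v3 : v ^+ 3 = 1.
    by rewrite exprVn (exprAC (z ^+ m)) (prim_expr_order w_prim) expr1n invr1.
  have vE j : z ^- (b * (j * m)) = v ^+ j.
    by rewrite exprVn -!exprM; congr (_ ^- _); ring.
  rewrite /N [(m * 3)%N]mulnC sum_dvdn_ord //.
  under eq_bigr do rewrite gE vE.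
  rewrite !big_ord_recl big_ord0 /= mulr0 add0r addr0 -mulrDl mulrC expr1.
  by rewrite (cube_root1_sum _ _ v3) invr_eq1 -(prim_order_dvd w_prim).
have NMZ : ((N%:R * M 2 b - 9 ^+ m * (if (3 %| b)%N then 2 else -1) : int)%:~R
    = \sum_(k < N | ~~ (m %| k)%N) g k :> algC).
  rewrite rmorphB rmorphM rmorph_nat NM (bigID (fun k : 'I_N => m %| k)%N) /=.
  rewrite main rmorphM rmorphXn /= addrC.
  rewrite (_ : (if _ then _ else _)%:~R = if (3 %| b)%N then 2 else -1).
    by rewrite addrK.
  by case: ifP => _; rewrite ?rmorphN1 ?rmorph_nat.
rewrite -(ler_int algC) intr_norm NMZ rmorphM rmorphXn /= rmorph_nat.
apply: le_trans (ler_norm_sum _ _ _) _.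
have z1 : `|z| = 1.
  by apply/eqP; rewrite -(pexpr_eq1 (n := N)) // -normrX prim_expr_order ?normr1.
(* Since |z| = 1, each of the at most N remaining terms is bounded by 3^m. *)
apply: (@le_trans _ _ (\sum_(k < N | ~~ (m %| k)%N) 3 ^+ m)).
  apply: ler_sum => k mk; rewrite /g normrM normfV normrX z1 expr1n invr1 mul1r.
  apply: norm_prod_oneB_not_cube_root1 => //; last by rewrite cubeE.
  by rewrite (exprAC z) (prim_expr_order z_prim) expr1n.
rewrite -[in leRHS](card_ord N) -sumr_const mulr_suml big_mkcond.
by apply: ler_sum => k _; rewrite mul1r; case: ifP => // _; rewrite exprn_ge0.
Qed.

(** * Signs and asymptotics *)

Lemma sqr_leq_exp3 (m : nat) : (m ^ 2 <= 3 ^ m)%N.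
Proof.
case: m => [//|n]; elim: n => [//|[|n] IHn] //.
by rewrite [leqRHS]expnS; nia.
Qed.

Lemma mul3_ltn_exp3 (n : nat) : (0 < n)%N -> (n.+1 * 3 < 3 ^ n.+1)%N.
Proof.
case: n => // n _; elim: n => [//|n IHn].
by rewrite [ltnRHS]expnS; nia.
Qed.

Lemma M_3_2_sign (n : nat) (b : 'Z_(modN 3 n)) :
  (0 < n)%N ->
  ((3 %| b)%N -> 0 < M 2 b) /\ (~~ (3 %| b)%N -> M 2 b < 0).
Proof.
move=> n_gt0; have := M_3_2_bound n b.
have N_gt0 : 0 < (n.+1 * 3)%:R :> int by rewrite ltr0n muln_gt0.
(* The error is smaller than the main term, of size at least 9^m. Here [n > 0] matters: at [n = 0]
   both sides equal 9. *)
have E_lt : (n.+1 * 3)%:R * 3 ^+ n.+1 < 9 ^+ n.+1 :> int.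
  rewrite (_ : 9 = 3 * 3) // exprMn ltr_pM2r ?exprn_gt0 // -natrX ltr_nat.
  exact: mul3_ltn_exp3.
have pos : 0 < 9 ^+ n.+1 :> int by rewrite exprn_gt0.
rewrite ler_norml => /andP[lo hi]; split=> [b3|/negPf b3]; rewrite b3 in lo hi.
  by rewrite -(pmulr_rgt0 _ N_gt0); lra.
by rewrite -(pmulr_rlt0 _ N_gt0); lra.
Qed.

(** Here [t] is the predicted main term. As |N t| >= 9^m, dividing the error bound by |N t| leaves
    at most 3 m / 3^m, and m^2 <= 3^m turns this into 3 / m, uniformly in [b]. *)
Lemma M_3_2_relative_error (R : realFieldType) (n : nat) (b : 'Z_(modN 3 n)) (t : R) :
  t * (n.+1 * 3)%:R = 9 ^+ n.+1 * (if (3 %| b)%N then 2 else -1) ->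
  `|(M 2 b)%:~R / t - 1| <= 3 / n.+1%:R.
Proof.
set c := if _ then _ else _ => tN.
have N_neq0 : (n.+1 * 3)%:R != 0 :> R by rewrite pnatr_eq0 muln_eq0.
have pos9 : 0 < 9 ^+ n.+1 :> R by rewrite exprn_gt0 // ltr0n.
have pos3 : 0 < 3 ^+ n.+1 :> R by rewrite exprn_gt0 // ltr0n.
have posm : 0 < n.+1%:R :> R by rewrite ltr0n.
have c_ge1 : 1 <= `|c|.
  by rewrite /c; case: ifP => _; rewrite ?normrN1 ?normr_nat ?ler1n.
have t_neq0 : t != 0.
  apply: contraTneq c_ge1 => t0; move/esym/eqP: tN; rewrite t0 mul0r mulf_eq0.
  by rewrite gt_eqF //= => /eqP ->; rewrite normr0 ler10.
set e := _ - 1.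
have eE : e * (9 ^+ n.+1 * c) = (n.+1 * 3)%:R * (M 2 b)%:~R - 9 ^+ n.+1 * c.
  by rewrite /e -tN; field.
have := M_3_2_bound n b.
rewrite -(ler_int R) intr_norm rmorphB !rmorphM !rmorphXn /= !rmorph_nat.
rewrite (_ : (if _ then _ else _)%:~R = c); last first.
  by rewrite /c; case: ifP => _; rewrite ?rmorphN1 ?rmorph_nat.
rewrite -eE !normrM (gtr0_norm pos9) => le_e.
have le_e3 : `|e| * 3 ^+ n.+1 <= n.+1%:R * 3.
  rewrite -(ler_pM2r pos3) -natrM; apply: le_trans le_e.
  by rewrite -mulrA ler_wpM2l // -exprMn -natrM ler_peMr // ltW.
rewrite ler_pdivlMr // -(ler_pM2r posm) -mulrA [leRHS]mulrC; apply: le_trans le_e3.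
rewrite ler_wpM2l // -!natrM -natrX ler_nat; exact: (sqr_leq_exp3 n.+1).
Qed.

Theorem theorem4p4 (R : realType) :
  (exists e : forall n : nat, 'Z_(modN 3 n) -> R,
     (forall (n : nat) (b : 'Z_(modN 3 n)), (0 < n)%N ->
        (M 2 b)%:~R =
          (if (3 %| b)%N then 2 * 3 ^+ (2 * n + 1) / (n + 1)%:R
           else - (3 ^+ (2 * n + 1) / (n + 1)%:R)) * (1 + e n b)) /\
     (forall eps : R, 0 < eps ->
        \forall n \near \oo, forall b : 'Z_(modN 3 n), `|e n b| < eps)) /\
  (forall (n : nat) (b : 'Z_(modN 3 n)), (0 < n)%N ->
     ((3 %| b)%N -> 0 < M 2 b) /\ (~~ (3 %| b)%N -> M 2 b < 0)).
Proof.
split; last by move=> n b; exact: M_3_2_sign.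
pose t n (b : 'Z_(modN 3 n)) : R :=
  if (3 %| b)%N then 2 * 3 ^+ (2 * n + 1) / (n + 1)%:R
  else - (3 ^+ (2 * n + 1) / (n + 1)%:R).
have tN n b : t n b * (n.+1 * 3)%:R = 9 ^+ n.+1 * (if (3 %| b)%N then 2 else -1).
  have n1 : n.+1%:R != 0 :> R by rewrite pnatr_eq0.
  (* The factor 3 split off here cancels the 3 in N = 3 (n + 1). *)
  have -> : 9 ^+ n.+1 = 3 * 3 ^+ (2 * n + 1) :> R.
    by rewrite -exprS (_ : (2 * n + 1).+1 = (2 * n.+1)%N) ?exprM;
      [congr (_ ^+ _); ring | lia].
  by rewrite /t addn1 natrM; case: ifP => _; field.
have t_neq0 n b : t n b != 0.
  have : t n b * (n.+1 * 3)%:R != 0.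
    rewrite tN mulf_neq0 ?expf_neq0 ?pnatr_eq0 //.
    by case: ifP => _; rewrite ?oppr_eq0 ?oner_eq0 ?pnatr_eq0.
  by rewrite mulf_eq0 negb_or => /andP[].
(* The relative error itself is the witness; the identity then only needs [t n b != 0]. *)
exists (fun n b => (M 2 b)%:~R / t n b - 1); split=> [n b _ | eps eps_gt0].
  by rewrite -/(t n b) addrC subrK mulrC divfK.
have eps3 : 0 < eps / 3 by rewrite divr_gt0.
(* The threshold for 1 / (n + 1) < eps / 3 does not depend on [b]. *)
have := near_infty_natSinv_lt (PosNum eps3).
apply: filterS => n /= n_lt b.
apply: le_lt_trans (M_3_2_relative_error R n b (t n b) (tN n b)) _.
by rewrite mulrC -ltr_pdivlMr.
Qed.
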